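(* Let $0<p<1$ and let $(\omega^*,\lambda^* )\in\mathbb{R}^n\times\mathbb{R}^r$ be a local optimum of the problem $$\min_{\omega,\lambda} f(\omega)\quad\text{s.t.}\quad 0\in\partial_\omega\left(G(\omega,\bar\lambda)+\lambda_1R_1(\omega)\right),\quad \lambda\in\Omega_\epsilon .$$ Suppose that a constraint qualification holds at $(\omega^*,\lambda^* )$ for the constraint system (in the variables $(\omega,\lambda)$, with the index set $I(\omega^* )$ fixed) $$\frac{\partial G(\omega,\bar\lambda)}{\partial\omega_j}+p\operatorname{sgn}(\omega_j)\lambda_1|\omega_j|^{p-1}\psi'(|\omega_j|^p)=0\ (j\notin I(\omega^* )),\qquad \omega_j=0\ (j\in I(\omega^* )),\qquad \lambda\in\Omega_\epsilon .$$ Then $(\omega^*,\lambda^* )$ is a bilevel KKT (BKKT) point.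
   Context: **Data.** $n,r\ge1$; $f:\mathbb{R}^n\to\mathbb{R}$ is continuously differentiable; $g,R_2,\dots,R_r:\mathbb{R}^n\to\mathbb{R}$ are twice continuously differentiable; $\epsilon>0$ is a fixed (small) parameter. The function $\psi:[0,\infty)\to\mathbb{R}$ is twice continuously differentiable on $[0,\infty)$ and there are constants $\alpha,\beta>0$ with $0<\psi'(t)\le\alpha$ and $-\beta\le\psi''(t)\le0$ for all $t\ge0$. Set $R_1(\omega)=\sum_{i=1}^n\psi(|\omega_i|^p)$. For $\lambda=(\lambda_1,\dots,\lambda_r)\in\mathbb{R}^r$ write $\bar\lambda=(\lambda_2,\dots,\lambda_r)$ and $G(\omega,\bar\lambda)=g(\omega)+\sum_{i=2}^r\lambda_iR_i(\omega)$. Let $\Omega_\epsilon=\{\lambda\in\mathbb{R}^r:\lambda_1\ge\epsilon,\ \lambda_i\ge0\ (i\ge2)\}$, $e_1=(1,0,\dots,0)\in\mathbb{R}^r$, $I(\omega)=\{j:\omega_j=0\}$. Inequalities between vectors are componentwise; $\operatorname{sgn}$ is the sign function with $\operatorname{sgn}(0)=0$. **Subdifferential.** For $h:\mathbb{R}^n\to\mathbb{R}$, $v$ is a regular subgradient of $h$ at $\bar x$ ($v\in\hat\partial h(\bar x)$) if $h(x)\ge h(\bar x)+v^T(x-\bar x)+o(\|x-\bar x\|)$; $v$ is a general subgradient ($v\in\partial h(\bar x)$) if there are $x^\nu\to\bar x$ and $v^\nu\in\hat\partial h(x^\nu)$ with $v^\nu\to v$ (all functions here are continuous). $\partial_\omega$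 is the general subdifferential with respect to $\omega$ (for fixed $\lambda$). **Constraint qualification.** A constraint qualification at $(\omega^*,\lambda^* )$ for a system of smooth equality/inequality constraints means a condition on the constraints under which, whenever $(\omega^*,\lambda^* )$ is a local minimizer of $f(\omega)$ subject to that system, there exist Lagrange multipliers with which it satisfies the standard KKT conditions (for example LICQ or MFCQ). Here $\lambda\in\Omega_\epsilon$ is viewed as the inequalities $\lambda-\epsilon e_1\ge0$. **BKKT point.** $(\omega^*,\lambda^* )\in\mathbb{R}^n\times\mathbb{R}^r$ is a BKKT point if there is $(\zeta^*,\eta^* )\in\mathbb{R}^n\times\mathbb{R}^r$ such that, with $\tilde\omega^*=(\omega_i^* )_{i\notin I(\omega^* )}$, $\tilde\zeta^*=(\zeta_i^* )_{i\notin I(\omega^* )}$ and $\nabla_{\tilde\omega}$ denoting differentiation in the coordinates $\omega_i$, $i\notin I(\omega^* )$, - $\nabla_{\tilde\omega}f(\omega^* )+\widetilde H\tilde\zeta^*=0$, where $\widetilde H=\nabla^2_{\tilde\omega\tilde\omega}G(\omega^*,\bar\lambda^* )+\operatorname{diag}\left(\lambda_1^*p(p-1)|\omega_i^*|^{p-2}\psi'(|\omega_i^*|^p)+\lambda_1^*p^2|\omega_i^*|^{2p-2}\psi''(|\omega_i^*|^p)\right)_{i\notin I(\omega^* )}$, - $\frac{\partial G}{\partial\omega_i}(\omega^*,\bar\lambda^* )+p\lambda_1^*\psi'(|\omega_i^*|^p)|\omega_i^*|^{p-1}\operatorname{sgn}(\omega_i^* )=0$ for $i\notin I(\omega^* )$,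 - $\zeta_i^*=0$ for $i\in I(\omega^* )$, - $p\sum_{i\notin I(\omega^* )}\psi'(|\omega_i^*|^p)|\omega_i^*|^{p-1}\operatorname{sgn}(\omega_i^* )\zeta_i^*=\eta_1^*$, - $\nabla_{\tilde\omega}R_j(\omega^* )^T\tilde\zeta^*=\eta_j^*$ for $j=2,\dots,r$, - $\lambda^*-\epsilon e_1\ge0$, $\eta^*\ge0$, $(\lambda^*-\epsilon e_1)^T\eta^*=0$. *)

(* Defs.v *)
From HB Require Import structures.
From mathcomp Require Import all_boot all_order all_algebra.
From mathcomp Require Import all_classical all_reals all_analysis.
Set Implicit Arguments.
Unset Strict Implicit.
Unset Printing Implicit Defensive.
Import Order.TTheory GRing.Theory Num.Theory.
Import numFieldNormedType.Exports.
Local Open Scope classical_set_scope.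
Local Open Scope ring_scope.

(* Vectors are row vectors.  The library norm on 'rV[R]_n is the max norm,
   which gives the same neighbourhoods, limits, little-o's and derivatives as
   the Euclidean norm. *)

Definition dot (R : realType) (n : nat) (u v : 'rV[R]_n) : R :=
  \sum_(i < n) u 0 i * v 0 i.

(* The spaces V below are finite dimensional, so continuity of all directional
   derivatives is continuity of the derivative. *)
Definition continuously_differentiable_at (R : realType) (V : normedModType R)
    (F : V -> R) (x : V) : Prop :=
  differentiable F x /\ forall v : V, {for x, continuous ('D_v F)}.

Definition C1 (R : realType) (V : normedModType R) (F : V -> R) : Prop :=
  forall x, continuously_differentiable_at F x.

Definition C2 (R : realType) (V : normedModType R) (F : V -> R) : Prop :=
  C1 F /\ forall v : V, C1 ('D_v F).

Definition partial (R : realType) (n : nat) (i : 'I_n) (F : 'rV[R]_n -> R)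
    (x : 'rV[R]_n) : R :=
  'D_(delta_mx 0 i) F x.

Definition hessian (R : realType) (n : nat) (F : 'rV[R]_n -> R)
    (x : 'rV[R]_n) : 'M[R]_n :=
  \matrix_(i, j) partial i (partial j F) x.

(* df is the derivative of f on [0, +oo), one-sided at 0; the values of f and
   df at negative reals are irrelevant. *)
Definition derivative_on_nonneg (R : realType) (f df : R -> R) : Prop :=
  forall t : R, 0 <= t ->
    (fun s => (f s - f t) / (s - t)) @ within [set s | 0 <= s] t^' --> df t.

Definition regular_subgradient (R : realType) (n : nat) (h : 'rV[R]_n -> R)
    (xbar v : 'rV[R]_n) : Prop :=
  exists2 rem : 'rV[R]_n -> R,
    rem =o_xbar (fun x => x - xbar) &
    forall x, h xbar + dot v (x - xbar) + rem x <= h x.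

(* h is meant to be continuous: h x_k --> h xbar is not required separately. *)
Definition general_subgradient (R : realType) (n : nat) (h : 'rV[R]_n -> R)
    (xbar v : 'rV[R]_n) : Prop :=
  exists x_ v_ : nat -> 'rV[R]_n,
    [/\ x_ k @[k --> \oo] --> xbar,
        v_ k @[k --> \oo] --> v &
        forall k, regular_subgradient h (x_ k) (v_ k)].

Definition local_minimizer (R : realType) (V : normedModType R) (obj : V -> R)
    (S : set V) (z : V) : Prop :=
  S z /\ \forall y \near z, S y -> obj z <= obj y.

(* The system h_e = 0 (e in eq_index), c_k >= 0 (k in ineq_index). *)
Record constraint_system (R : realType) (V : Type) := ConstraintSystem {
  eq_index : finType;
  ineq_index : finType;
  eq_cstr : eq_index -> V -> R;
  ineq_cstr : ineq_index -> V -> R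
}.

Definition feasible (R : realType) (V : Type) (sys : constraint_system R V) :
    set V :=
  [set z | (forall e : eq_index sys, eq_cstr e z = 0) /\
           (forall k : ineq_index sys, 0 <= ineq_cstr k z)].

(* Smoothness of the constraints is only meaningful near the point of interest:
   functions such as |w_j|^(p-1) are singular at w_j = 0. *)
Definition smooth_near (R : realType) (V : normedModType R)
    (sys : constraint_system R V) (z : V) : Prop :=
  (forall e : eq_index sys, \forall y \near z,
     continuously_differentiable_at (eq_cstr e) y) /\
  (forall k : ineq_index sys, \forall y \near z,
     continuously_differentiable_at (ineq_cstr k) y).

(* Stationarity of the Lagrangian is stated as the vanishing of its derivative
   in every direction of V. *)
Definition KKT (R : realType) (V : normedModType R) (obj : V -> R)
    (sys : constraint_system R V) (z : V) : Prop :=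
  feasible sys z /\
  exists (mu : eq_index sys -> R) (nu : ineq_index sys -> R),
    [/\ forall v : V,
          'D_v obj z + \sum_e mu e * 'D_v (eq_cstr e) z
            - \sum_k nu k * 'D_v (ineq_cstr k) z = 0,
        forall k, 0 <= nu k &
        forall k, nu k * ineq_cstr k z = 0].

(* Q is a constraint qualification (such as LICQ or MFCQ) for the minimization
   of obj. *)
Definition constraint_qualification (R : realType) (V : normedModType R)
    (obj : V -> R) (Q : constraint_system R V -> V -> Prop) : Prop :=
  forall (sys : constraint_system R V) (z : V),
    smooth_near sys z -> Q sys z ->
    local_minimizer obj (feasible sys) z -> KKT obj sys z.

(* The hyperparameter vector is lam : 'rV_m.+1 with m + 1 = r, so lam 0 0 is
   lambda_1, col' 0 lam is (lambda_2, ..., lambda_r), and Rs i with i : 'I_m is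
   R_(i+2). *)

Definition R1 (R : realType) (n : nat) (p : R) (psi : R -> R)
    (w : 'rV[R]_n) : R :=
  \sum_(i < n) psi (`|w 0 i| `^ p).

Definition G (R : realType) (n m : nat) (g : 'rV[R]_n -> R)
    (Rs : 'I_m -> 'rV[R]_n -> R) (w : 'rV[R]_n) (lbar : 'rV[R]_m) : R :=
  g w + \sum_(i < m) lbar 0 i * Rs i w.

Definition e1 (R : realType) (m : nat) : 'rV[R]_m.+1 := delta_mx 0 0.

Definition Omega (R : realType) (m : nat) (eps : R) : set 'rV[R]_m.+1 :=
  [set lam | eps <= lam 0 0 /\ forall i : 'I_m, 0 <= lam 0 (lift 0 i)].

Definition zero_indices (R : realType) (n : nat) (w : 'rV[R]_n) : {set 'I_n} :=
  finset (fun j => w 0 j == 0).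

Definition bilevel_feasible (R : realType) (n m : nat) (p eps : R)
    (psi : R -> R) (g : 'rV[R]_n -> R) (Rs : 'I_m -> 'rV[R]_n -> R) :
    set ('rV[R]_n * 'rV[R]_m.+1) :=
  [set z | general_subgradient
             (fun w => G g Rs w (col' 0 z.2) + z.2 0 0 * R1 p psi w) z.1 0 /\
           Omega eps z.2].

(* dpsi is the derivative of psi. *)
Definition stationarity (R : realType) (n m : nat) (p : R) (dpsi : R -> R)
    (g : 'rV[R]_n -> R) (Rs : 'I_m -> 'rV[R]_n -> R) (j : 'I_n)
    (w : 'rV[R]_n) (lam : 'rV[R]_m.+1) : R :=
  partial j (fun w' => G g Rs w' (col' 0 lam)) w
    + p * Num.sg (w 0 j) * lam 0 0 * `|w 0 j| `^ (p - 1)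
        * dpsi (`|w 0 j| `^ p).

(* There is one equality per coordinate j: w_j = 0 if j is in I, the
   stationarity equation otherwise. *)
Definition reduced_system (R : realType) (n m : nat) (p eps : R)
    (dpsi : R -> R) (g : 'rV[R]_n -> R) (Rs : 'I_m -> 'rV[R]_n -> R)
    (I : {set 'I_n}) : constraint_system R ('rV[R]_n * 'rV[R]_m.+1) :=
  @ConstraintSystem R ('rV[R]_n * 'rV[R]_m.+1)%type 'I_n 'I_m.+1
    (fun j z => if j \in I then z.1 0 j
                else stationarity p dpsi g Rs j z.1 z.2)
    (fun k z => (z.2 - eps *: e1 R m) 0 k).

(* The block of entries (i, j) with i and j outside zero_indices w is the
   matrix H~ of the definition; the other entries are not used. *)
Definition Htilde (R : realType) (n m : nat) (p : R) (dpsi ddpsi : R -> R)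
    (g : 'rV[R]_n -> R) (Rs : 'I_m -> 'rV[R]_n -> R)
    (w : 'rV[R]_n) (lam : 'rV[R]_m.+1) : 'M[R]_n :=
  hessian (fun w' => G g Rs w' (col' 0 lam)) w
  + diag_mx (\row_i
      (lam 0 0 * p * (p - 1) * `|w 0 i| `^ (p - 2) * dpsi (`|w 0 i| `^ p)
       + lam 0 0 * p ^+ 2 * `|w 0 i| `^ (2 * p - 2) * ddpsi (`|w 0 i| `^ p))).

Record BKKT_conditions (R : realType) (n m : nat) (p eps : R)
    (dpsi ddpsi : R -> R) (f g : 'rV[R]_n -> R) (Rs : 'I_m -> 'rV[R]_n -> R)
    (w : 'rV[R]_n) (lam : 'rV[R]_m.+1)
    (zeta : 'rV[R]_n) (eta : 'rV[R]_m.+1) : Prop := {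
  BKKT_upper : forall i, i \notin zero_indices w ->
    partial i f w
      + \sum_(j | j \notin zero_indices w)
          Htilde p dpsi ddpsi g Rs w lam i j * zeta 0 j = 0;
  BKKT_lower : forall i, i \notin zero_indices w ->
    partial i (fun w' => G g Rs w' (col' 0 lam)) w
      + p * lam 0 0 * dpsi (`|w 0 i| `^ p) * `|w 0 i| `^ (p - 1)
          * Num.sg (w 0 i) = 0;
  BKKT_zeta : forall i, i \in zero_indices w -> zeta 0 i = 0;
  BKKT_eta1 :
    p * (\sum_(i | i \notin zero_indices w)
           dpsi (`|w 0 i| `^ p) * `|w 0 i| `^ (p - 1) * Num.sg (w 0 i)
             * zeta 0 i) = eta 0 0;
  BKKT_eta : forall j : 'I_m,
    \sum_(i | i \notin zero_indices w) partial i (Rs j) w * zeta 0 i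
      = eta 0 (lift 0 j);
  BKKT_primal : forall k, 0 <= (lam - eps *: e1 R m) 0 k;
  BKKT_dual : forall k, 0 <= eta 0 k;
  BKKT_compl : dot (lam - eps *: e1 R m) eta = 0
}.

Definition BKKT_point (R : realType) (n m : nat) (p eps : R)
    (dpsi ddpsi : R -> R) (f g : 'rV[R]_n -> R) (Rs : 'I_m -> 'rV[R]_n -> R)
    (w : 'rV[R]_n) (lam : 'rV[R]_m.+1) : Prop :=
  exists (zeta : 'rV[R]_n) (eta : 'rV[R]_m.+1),
    BKKT_conditions p eps dpsi ddpsi f g Rs w lam zeta eta.

(* Main.v *)
Require Import Defs.
From HB Require Import structures.
From mathcomp Require Import all_boot all_order all_algebra.
From mathcomp Require Import all_classical all_reals all_analysis.
From mathcomp Require Import ring lra.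
Set Implicit Arguments.
Unset Strict Implicit.
Unset Printing Implicit Defensive.
Import Order.TTheory GRing.Theory Num.Theory.
Import numFieldNormedType.Exports.
Local Open Scope classical_set_scope.
Local Open Scope ring_scope.

(* Where w_j <> 0 the lower-level objective has a partial derivative in w_j, so
   a regular subgradient must agree with it; by continuity, the stationarity
   equation holds at every bilevel feasible point.  Conversely, near (w, lam) a
   point satisfying the reduced system is bilevel feasible: in the coordinates
   vanishing at w the penalty grows like |t|^p with p < 1, which dominates any
   linear term, so 0 is even a regular subgradient there.  Hence (w, lam) is a
   local minimizer of the reduced smooth problem, whose KKT multipliers of the
   stationarity equations and of the bounds on lambda are zeta and eta. *)

(** * Pointwise continuity of real-valued functions *)

Section ContinuousAt.
Variables (R : realType) (T : topologicalType).
Implicit Types (f h : T -> R) (x : T).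

Lemma continuous_at_cst (a : R) x : {for x, continuous (fun _ : T => a)}.
Proof. exact: cvg_cst. Qed.

Lemma continuous_at_add f h x :
  {for x, continuous f} -> {for x, continuous h} ->
  {for x, continuous (fun y => f y + h y)}.
Proof. exact: continuousD. Qed.

Lemma continuous_at_mul f h x :
  {for x, continuous f} -> {for x, continuous h} ->
  {for x, continuous (fun y => f y * h y)}.
Proof. exact: continuousM. Qed.

Lemma continuous_at_sum (k : nat) (F : 'I_k -> T -> R) x :
  (forall i, {for x, continuous (F i)}) ->
  {for x, continuous (fun y => \sum_(i < k) F i y)}.
Proof.
by move=> Fc; apply: cvg_big => [|i _]; [exact: add_continuous|exact: Fc].
Qed.

End ContinuousAt.

(** * One-variable calculus of the penalty psi(|t|^p) *)

Lemma is_derive_derivative_on_nonneg (R : realType) (f df : R -> R) (t : R) :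
  derivative_on_nonneg f df -> 0 < t -> is_derive t (1 : R) f (df t).
Proof.
move=> dfP t0.
suff H : (fun h : R => h^-1 *: ((f \o shift t) (h *: (1 : R)) - f t)) @ 0^'
    --> df t.
  by split; [apply/cvg_ex; exists (df t)|exact: cvg_lim].
have /cvgrPdist_lt dft := dfP t (ltW t0).
apply/cvgrPdist_lt => e e0.
have /nbhs_ballP[d /= d0 dP] := dft e e0.
(* An increment with |h| < t keeps h + t nonnegative, so the quotient restricted to the half-line is
   the ordinary two-sided one. *)
apply/nbhs_ballP; exists (Num.min d t) => /=; first by rewrite lt_min d0.
move=> h; rewrite /ball /= sub0r normrN lt_min => /andP[hd ht] h0.
have := dP (h + t); rewrite /ball /= opprD addrCA subrr addr0 normrN.
rewrite addrK => /(_ hd) /=.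
rewrite -subr_eq0 addrK => /(_ h0).
have -> : 0 <= h + t by move: ht; rewrite ltr_norml => /andP[]; lra.
by move=> /(_ isT); rewrite [_ / h]mulrC [h%:A](mulr1).
Qed.

(** The derivative of psi(|t|^p) at t <> 0; at t = 0 the sign factor gives the value 0. *)
Definition dpenalty (R : realType) (p : R) (dpsi : R -> R) (t : R) : R :=
  p * Num.sg t * `|t| `^ (p - 1) * dpsi (`|t| `^ p).

(** The derivative of [dpenalty] at t <> 0, with the factor sgn(t)^2 = 1 already removed. Multiplied
    by lambda_1 it is the diagonal term of [Htilde]. *)
Definition ddpenalty (R : realType) (p : R) (dpsi ddpsi : R -> R) (t : R) : R :=
  p * (p - 1) * `|t| `^ (p - 2) * dpsi (`|t| `^ p)
  + p ^+ 2 * `|t| `^ (2 * p - 2) * ddpsi (`|t| `^ p).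

(** Lets |s| be replaced by a linear function, and the sign by a constant, in every derivative taken
    away from 0. *)
Lemma near_norm_sg (R : realType) (t : R) : t != 0 ->
  \forall s \near t, Num.sg s = Num.sg t /\ `|s| = Num.sg t * s.
Proof.
move=> t0; have [t1|t1|t1] := ltgtP t 0; last by rewrite t1 eqxx in t0.
- near=> s; have s0 : s < 0 by near: s; exact: lt_nbhsl.
  by rewrite !ltr0_sg// ltr0_norm// mulN1r.
- near=> s; have s0 : 0 < s by near: s; exact: lt_nbhsr.
  by rewrite !gtr0_sg// gtr0_norm// mul1r.
Unshelve. all: by end_near. Qed.

Lemma is_derive_norm (R : realType) (t : R) : t != 0 ->
  is_derive t (1 : R) (fun s : R => `|s|) (Num.sg t).
Proof.
move=> t0; apply: (@near_eq_is_derive R R R (fun s => Num.sg t * s)).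
  by near=> s; apply/esym; have [] : Num.sg s = Num.sg t /\ `|s| = Num.sg t * s
    by near: s; exact: near_norm_sg.
by apply: is_derive_eq; rewrite /GRing.scale /= mulr1.
Unshelve. all: by end_near. Qed.

Lemma is_derive_norm_powR (R : realType) (q t : R) : t != 0 ->
  is_derive t (1 : R) (fun s : R => `|s| `^ q) (q * Num.sg t * `|t| `^ (q - 1)).
Proof.
move=> t0; have h := is_derive_norm t0.
have t1 : 0 < `|t| by rewrite normr_gt0.
have := @is_derive1_comp R (fun x => x `^ q) (fun s : R => `|s|) t _ _
  (is_derive1_powR q t1) h.
by rewrite /comp mulrAC => ?; exact: is_derive_eq.
Qed.

Lemma is_derive_dpenalty (R : realType) (p : R) (dpsi ddpsi : R -> R) (t : R) :
  derivative_on_nonneg dpsi ddpsi -> t != 0 ->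
  is_derive t (1 : R) (dpenalty p dpsi) (ddpenalty p dpsi ddpsi t).
Proof.
move=> dP t0.
have t1 : 0 < `|t| by rewrite normr_gt0.
(* The sign is frozen at its value at [t], which leaves a product of functions of |s|. *)
apply: (@near_eq_is_derive R R R
  (fun s => p * Num.sg t * `|s| `^ (p - 1) * dpsi (`|s| `^ p))).
  near=> s; rewrite /dpenalty; congr (_ * _ * _ * _); apply/esym.
  by have [] : Num.sg s = Num.sg t /\ `|s| = Num.sg t * s
    by near: s; exact: near_norm_sg.
have h1 := is_derive_norm_powR (p - 1) t0.
have h2 : is_derive t (1 : R) (fun s => dpsi (`|s| `^ p))
    (ddpsi (`|t| `^ p) * (p * Num.sg t * `|t| `^ (p - 1))).
  apply: (@is_derive1_comp R dpsi (fun s => `|s| `^ p)).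
    exact: (is_derive_derivative_on_nonneg dP (powR_gt0 _ t1)).
  exact: is_derive_norm_powR.
have h3 : is_derive t (1 : R) (fun s => p * Num.sg t * `|s| `^ (p - 1))
    (p * Num.sg t * ((p - 1) * Num.sg t * `|t| `^ (p - 1 - 1))).
  exact: is_deriveZ.
apply: (is_derive_eq (is_deriveM h3 h2)).
rewrite /ddpenalty /GRing.scale /=.
(* One factor |t|^(p-1) is already in [dpenalty], the other comes from the chain rule inside [dpsi];
   the two signs multiply to 1. *)
have -> : 2 * p - 2 = (p - 1) + (p - 1) by ring.
rewrite (powRD (r := p - 1) (s := p - 1)); last by rewrite normr_eq0 t0 implybT.
have -> : p - 1 - 1 = p - 2 by ring.
have sg1 : Num.sg t ^+ 2 = 1 by rewrite sqr_sg t0.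
ring: sg1.
Unshelve. all: by end_near. Qed.

Lemma is_derive_psi_norm_powR (R : realType) (p : R) (psi dpsi : R -> R)
    (t : R) :
  derivative_on_nonneg psi dpsi -> t != 0 ->
  is_derive t (1 : R) (fun s => psi (`|s| `^ p)) (dpenalty p dpsi t).
Proof.
move=> dP t0.
have t1 : 0 < `|t| by rewrite normr_gt0.
have h := @is_derive1_comp R psi (fun s => `|s| `^ p) t _ _
  (is_derive_derivative_on_nonneg dP (powR_gt0 p t1))
  (is_derive_norm_powR p t0).
by apply: (is_derive_eq h); rewrite /dpenalty mulrC.
Qed.

Lemma is_derive_continuous (R : realType) (f : R -> R) (t df : R) :
  is_derive t (1 : R) f df -> {for t, continuous f}.
Proof.
by move=> [h _]; apply: differentiable_continuous; apply/derivable1_diffP.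
Qed.

Lemma continuous_dpenalty (R : realType) (p : R) (dpsi ddpsi : R -> R) (t : R) :
  derivative_on_nonneg dpsi ddpsi -> t != 0 ->
  {for t, continuous (dpenalty p dpsi)}.
Proof.
move=> dP t0; exact: (is_derive_continuous (is_derive_dpenalty p dP t0)).
Qed.

Lemma continuous_ddpenalty (R : realType) (p : R) (dpsi ddpsi : R -> R)
    (t : R) :
  derivative_on_nonneg dpsi ddpsi ->
  {within [set t | 0 <= t], continuous ddpsi} -> t != 0 ->
  {for t, continuous (ddpenalty p dpsi ddpsi)}.
Proof.
move=> dP cdd t0.
have t1 : 0 < `|t| by rewrite normr_gt0.
have t2 : 0 < `|t| `^ p by exact: powR_gt0.
have c q : {for t, continuous (fun s : R => `|s| `^ q)}.
  exact: (is_derive_continuous (is_derive_norm_powR q t0)).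
have cc : {for t, continuous (fun s : R => ddpsi (`|s| `^ p))}.
  apply: (@continuous_comp _ _ _ (fun s : R => `|s| `^ p) ddpsi) => //.
  (* Continuity of [ddpsi] is relative to the closed half-line; |t|^p lies in its interior, where
     this is ordinary continuity. *)
  have : {within [set t : R | 0 < t], continuous ddpsi}.
    by apply: continuous_subspaceW cdd => s; exact: ltW.
  by rewrite continuous_open_subspace; [apply; rewrite inE|exact: open_gt].
apply: cvgD; apply: cvgM.
- apply: cvgM; [exact: cvg_cst|exact: c].
- apply: (@continuous_comp _ _ _ (fun s : R => `|s| `^ p) dpsi); first exact: c.
  exact: (is_derive_continuous (is_derive_derivative_on_nonneg dP t2)).
- apply: cvgM; [exact: cvg_cst|exact: c].
- exact: cc.
Qed.

(** Since [dpsi 0] is positive, psi(s) - psi(0) is at least a positive multiple of s for small s >=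
    0. With s = |t|^p, the identity |t| = |t|^(1-p) |t|^p makes |t| negligible against s, because 1
    - p > 0. *)
Lemma near_psi_norm_powR_ge (R : realType) (p : R) (psi dpsi : R -> R) (C : R) :
  0 < p -> p < 1 -> derivative_on_nonneg psi dpsi -> 0 < dpsi 0 ->
  \forall t \near (0 : R), C * `|t| <= psi (`|t| `^ p) - psi 0.
Proof.
move=> p0 p1 dP d0; pose c := dpsi 0 / 2.
have c0 : 0 < c by rewrite divr_gt0.
have psi_ge : exists2 d : R, 0 < d &
    forall s : R, 0 <= s -> s < d -> c * s <= psi s - psi 0.
  have /cvgrPdist_lt/(_ c c0)/nbhs_ballP[d /= dgt0 dP0] := dP 0 (lexx _).
  exists d => // s s0 sd; have [->|sn0] := eqVneq s 0.
    by rewrite mulr0 subrr.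
  have := dP0 s; rewrite /ball /= sub0r normrN ger0_norm// => /(_ sd sn0 s0).
  rewrite subr0 -ler_pdivlMr; last by rewrite lt_def sn0.
  move=> /ltr_distlBl.
  by have -> : dpsi 0 - c = c by [rewrite /c; field]; exact: ltW.
have [d dgt0 dP0] := psi_ge.
(* A positive upper bound of [C], by which one may divide. *)
pose C1 : R := `|C| + 1.
have C1gt0 : 0 < C1 by rewrite ltr_wpDl.
have q0 : 0 < 1 - p by rewrite subr_gt0.
(* Two smallness conditions are imposed: |t|^p < d and |t|^(1-p) < c / C1. Writing each threshold as
   a power turns it into a bound on |t|. *)
near=> t.
have td : `|t| `^ p < d.
  have -> : d = (d `^ p^-1) `^ p.
    by rewrite -powRrM mulVf ?gt_eqF// powRr1// ltW.
  apply: gt0_ltr_powR => //; rewrite ?nnegrE ?powR_ge0//.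
  by near: t; apply: (@nbhs0_lt R R); exact: powR_gt0.
have tq : `|t| `^ (1 - p) < c / C1.
  have -> : c / C1 = ((c / C1) `^ (1 - p)^-1) `^ (1 - p).
    by rewrite -powRrM mulVf ?gt_eqF// powRr1// ltW// divr_gt0.
  apply: gt0_ltr_powR => //; rewrite ?nnegrE ?powR_ge0//.
  by near: t; apply: (@nbhs0_lt R R); apply: powR_gt0; rewrite divr_gt0.
apply: le_trans (dP0 _ (powR_ge0 _ _) td).
apply: (@le_trans _ _ (C1 * `|t|)).
  by apply: ler_wpM2r => //; rewrite /C1; have := ler_norm C; lra.
have [->|t0] := eqVneq t 0.
  by rewrite normr0 mulr0 mulr_ge0 ?powR_ge0 ?ltW.
have tE : `|t| = `|t| `^ (1 - p) * `|t| `^ p.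
  by rewrite -powRD ?normr_eq0 ?t0 ?implybT// subrK powRr1.
rewrite [in leLHS]tE mulrA; apply: ler_wpM2r; first exact: powR_ge0.
by rewrite mulrC -ler_pdivlMr// ltW.
Unshelve. all: by end_near. Qed.

(** * Directional derivatives and regular subgradients *)

Lemma derive_partialE (R : realType) (n : nat) (F : 'rV[R]_n -> R)
    (x v : 'rV[R]_n) : differentiable F x ->
  'D_v F x = \sum_i v 0 i * partial i F x.
Proof.
move=> dF; rewrite deriveE// {1}(row_sum_delta v) linear_sum.
by apply: eq_bigr => i _; rewrite linearZ /partial deriveE.
Qed.

(** Stated for a single direction [u], so that it applies along one coordinate axis even when the
    penalty is singular in another coordinate. *)
Lemma derive_regular_subgradient (R : realType) (n : nat) (h : 'rV[R]_n -> R)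
    (x v u : 'rV[R]_n) :
  regular_subgradient h x v -> derivable h x u -> 'D_u h x = dot v u.
Proof.
move=> [rem /eqoP rem0 hge] /cvgrPdist_le /= hu.
apply/eqP; rewrite -subr_eq0 -normr_le0; apply/ler_addgt0Pl => e e0.
rewrite addr0.
(* For a step of length t along [u], the remainder is at most (e / K) t |u| <= t e / 2; the
   difference quotient accounts for the other half of e. The 1 keeps [K] positive when u = 0. *)
pose K := 2 * (`|u| + 1).
have K0 : 0 < K by rewrite mulr_gt0// ltr_wpDl.
have e1 : 0 < e / K by rewrite divr_gt0.
have e2 : 0 < e / 2 by rewrite divr_gt0.
have /(nbhs_ballP _ _) [r /= r0 rP] := rem0 _ e1.
have /(nbhs_ballP _ _) [s /= s0 sP] := hu _ e2.
pose q := Num.min s (r / (`|u| + 1)).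
pose t := q / 2.
have u1 : 0 < `|u| + 1 by rewrite ltr_wpDl.
have q0 : 0 < q by rewrite lt_min s0 divr_gt0.
have t0 : 0 < t by rewrite divr_gt0.
have tq : t < q by rewrite /t; lra.
have ts : t < s by apply: lt_le_trans tq _; rewrite ge_min lexx.
have tr : t * `|u| < r.
  apply: (@lt_le_trans _ _ (t * (`|u| + 1))).
    by rewrite ltr_pM2l// ltrDl.
  rewrite -ler_pdivlMr//; apply: le_trans (ltW tq) _.
  by rewrite ge_min lexx orbT.
have dotZ a : dot v (a *: u) = a * dot v u.
  by rewrite /dot mulr_sumr; apply: eq_bigr => i _; rewrite mxE mulrCA.
(* Used with both signs of a, which turns the one-sided subgradient inequality
   into an equality of derivatives. *)
have key a : `|a| = t -> a * dot v u <= a * 'D_u h x + t * e.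
  move=> at_.
  have a0 : a != 0 by rewrite -normr_eq0 at_ gt_eqF.
  have := sP a; rewrite /ball /= sub0r normrN at_ => /(_ ts a0).
  have xa : x + a *: u - x = a *: u by rewrite addrAC subrr add0r.
  have bx : ball x r (x + a *: u).
    by rewrite -ball_normE /ball_ /= -opprB xa normrN normrZ at_.
  have := rP _ bx; rewrite /= xa normrZ at_ => remle.
  have := hge (x + a *: u); rewrite xa dotZ => hle.
  have remle2 : `|rem (x + a *: u)| <= t * (e / 2).
    apply: le_trans remle _; rewrite mulrCA ler_pM2l//.
    have -> : e / K * `|u| = e / 2 * (`|u| / (`|u| + 1)).
      by rewrite /K invfM; ring.
    by apply: ler_piMr; [exact: ltW|rewrite ler_pdivrMr// mul1r lerDl].
  move=> qle.
  have : `|a * 'D_u h x - (h (x + a *: u) - h x)| <= t * (e / 2).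
    rewrite -at_ -[X in `|a * _ - X|](mulVKf a0) -mulrBr normrM.
    by rewrite ler_pM2l ?normr_gt0// [x + _]addrC.
  move: remle2; rewrite !ler_norml => /andP[+ _] /andP[+ _]; lra.
have h1 := key t (gtr0_norm t0).
have h2 := key (- t) (etrans (normrN _) (gtr0_norm t0)).
have h1' : dot v u - 'D_u h x <= e by rewrite -(ler_pM2l t0); lra.
have h2' : 'D_u h x - dot v u <= e by rewrite -(ler_pM2l t0); lra.
by rewrite ler_norml; apply/andP; split; lra.
Qed.

(** * Calculus of the lower-level objective *)

Section Objective.
Variables (R : realType) (n m : nat).
Variables (g : 'rV[R]_n -> R) (Rs : 'I_m -> 'rV[R]_n -> R).
Implicit Types (w x u v : 'rV[R]_n).

Lemma GE (lbar : 'rV[R]_m) :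
  (fun w => G g Rs w lbar) = g + \sum_(i < m) lbar 0 i *: Rs i.
Proof. by apply/funext => w; rewrite /G fctE fct_sumE. Qed.

Lemma differentiable_G (lbar : 'rV[R]_m) x :
  differentiable g x -> (forall i, differentiable (Rs i) x) ->
  differentiable (fun w => G g Rs w lbar) x.
Proof.
move=> dg dRs; rewrite GE; apply: differentiableD => //.
by apply: differentiable_sum => i; exact: differentiableZ.
Qed.

Lemma derive_G (lbar : 'rV[R]_m) x v :
  differentiable g x -> (forall i, differentiable (Rs i) x) ->
  'D_v (fun w => G g Rs w lbar) x =
  'D_v g x + \sum_(i < m) lbar 0 i * 'D_v (Rs i) x.
Proof.
move=> dg dRs; rewrite GE deriveD; last 2 first.
- exact: diff_derivable.
- by apply: derivable_sum => i; apply: derivableZ; exact: diff_derivable.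
rewrite derive_sum => [|i]; last by apply: derivableZ; exact: diff_derivable.
congr (_ + _); apply: eq_bigr => i _.
by rewrite deriveZ//; exact: diff_derivable.
Qed.

End Objective.

Lemma differentiable_real_comp (R : realType) (V : normedModType R) (F : V -> R)
    (phi : R -> R) (dphi : R) (x : V) :
  differentiable F x -> is_derive (F x) (1 : R) phi dphi ->
  differentiable (phi \o F) x.
Proof.
move=> dF [dphi1 _].
by apply: differentiable_comp => //; apply/derivable1_diffP.
Qed.

Lemma derive_real_comp (R : realType) (V : normedModType R) (F : V -> R)
    (phi : R -> R) (dphi : R) (x v : V) :
  differentiable F x -> is_derive (F x) (1 : R) phi dphi ->
  'D_v (phi \o F) x = 'D_v F x * dphi.
Proof.
move=> dF dphiP; have dc := differentiable_real_comp dF dphiP.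
case: dphiP => /[dup] d1 /derivable1_diffP d2 <-.
rewrite !deriveE// diff_comp//=; set y := 'd F x v.
(* A linear map on the line is multiplication by its value at 1. *)
by rewrite -[in LHS](mulr1 y) (linearZZ ('d phi (F x)) y 1).
Qed.

Lemma derive_coord (R : realType) (n : nat) (i : 'I_n) (x v : 'rV[R]_n) :
  'D_v (fun w : 'rV[R]_n => w 0 i) x = v 0 i.
Proof.
apply/lim_near_cst => //; near=> h.
have h0 : h != 0 by near: h; exact: nbhs_dnbhs_neq.
by rewrite /= !mxE addrK [_ *: _]mulKf.
Unshelve. all: by end_near. Qed.

(** Moving along [v] does not change coordinate [i], so the difference quotient is identically 0 for
    an arbitrary [phi]. This handles the terms of [R1] that are singular at a vanishing
    coordinate. *)
Lemma is_derive_coord_fixed (R : realType) (n : nat) (i : 'I_n)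
    (phi : R -> R) (x v : 'rV[R]_n) : v 0 i = 0 ->
  is_derive x v (fun w : 'rV[R]_n => phi (w 0 i)) 0.
Proof.
move=> vi0.
have cst0 : (fun h : R => h^-1 *: (((fun w : 'rV[R]_n => phi (w 0 i))
    \o shift x) (h *: v) - phi (x 0 i))) = cst 0.
  by apply/funext => h /=; rewrite !mxE vi0 mulr0 add0r subrr scaler0.
split; first by rewrite /derivable cst0; exact: is_cvg_cst.
by rewrite /derive cst0 lim_cst.
Qed.

Lemma differentiable_coord_psi (R : realType) (n : nat) (i : 'I_n) (p : R)
    (psi dpsi : R -> R) (x : 'rV[R]_n) :
  derivative_on_nonneg psi dpsi -> x 0 i != 0 ->
  differentiable (fun w : 'rV[R]_n => psi (`|w 0 i| `^ p)) x.
Proof.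
move=> dP xi0.
apply: (@differentiable_real_comp _ _ (fun w : 'rV[R]_n => w 0 i)
  (fun t => psi (`|t| `^ p))); first exact: differentiable_coord.
exact: (is_derive_psi_norm_powR p dP xi0).
Qed.

Lemma derive_coord_psi (R : realType) (n : nat) (i : 'I_n) (p : R)
    (psi dpsi : R -> R) (x v : 'rV[R]_n) :
  derivative_on_nonneg psi dpsi -> x 0 i != 0 ->
  'D_v (fun w : 'rV[R]_n => psi (`|w 0 i| `^ p)) x
    = v 0 i * dpenalty p dpsi (x 0 i).
Proof.
move=> dP xi0.
have := @derive_real_comp _ _ (fun w : 'rV[R]_n => w 0 i)
  (fun t => psi (`|t| `^ p)) (dpenalty p dpsi (x 0 i)) x v
  (differentiable_coord _ _ _).
by rewrite derive_coord; apply; exact: (is_derive_psi_norm_powR p dP xi0).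
Qed.

(** * From subgradients to the stationarity equations *)

Lemma stationarityE (R : realType) (n m : nat) (p : R) (dpsi : R -> R)
    (g : 'rV[R]_n -> R) (Rs : 'I_m -> 'rV[R]_n -> R) (j : 'I_n)
    (w : 'rV[R]_n) (lam : 'rV[R]_m.+1) :
  stationarity p dpsi g Rs j w lam =
  partial j (fun w' => G g Rs w' (col' 0 lam)) w
    + lam 0 0 * dpenalty p dpsi (w 0 j).
Proof. by rewrite /stationarity /dpenalty; congr (_ + _); ring. Qed.

Lemma dot_delta (R : realType) (n : nat) (u : 'rV[R]_n) (j : 'I_n) :
  dot u (delta_mx 0 j) = u 0 j.
Proof.
rewrite /dot (bigD1 j)//= mxE !eqxx mulr1 big1 ?addr0// => i ij.
by rewrite mxE (negbTE ij) andbF mulr0.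
Qed.

(** Along the j-th axis only the j-th term of [R1] varies, and it is smooth since x_j <> 0. The
    objective thus has a derivative in that direction, which the subgradient must match. *)
Lemma regular_subgradient_stationarity (R : realType) (n m : nat) (p : R)
    (psi dpsi : R -> R) (g : 'rV[R]_n -> R) (Rs : 'I_m -> 'rV[R]_n -> R)
    (lam : 'rV[R]_m.+1) (x v : 'rV[R]_n) (j : 'I_n) :
  derivative_on_nonneg psi dpsi ->
  differentiable g x -> (forall i, differentiable (Rs i) x) -> x 0 j != 0 ->
  regular_subgradient
    (fun w => G g Rs w (col' 0 lam) + lam 0 0 * R1 p psi w) x v ->
  v 0 j = stationarity p dpsi g Rs j x lam.
Proof.
move=> dP dg dRs xj0 vP.
pose e : 'rV[R]_n := delta_mx 0 j.
pose S : 'rV[R]_n -> R :=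
  \sum_(i < n) (fun w : 'rV[R]_n => psi (`|w 0 i| `^ p)).
have dR1 : is_derive x e S
    (\sum_(i < n) (if i == j then dpenalty p dpsi (x 0 j) else 0)).
  apply: is_derive_sum => i; case: eqVneq => [->|ij].
    split.
      by apply: diff_derivable; exact: differentiable_coord_psi dP xj0.
    by rewrite (derive_coord_psi _ _ dP xj0) /e mxE !eqxx mul1r.
  apply: (@is_derive_coord_fixed _ _ i (fun t => psi (`|t| `^ p))).
  by rewrite /e mxE (negbTE ij) andbF.
rewrite -big_mkcond big_pred1_eq in dR1.
have dG : derivable (fun w => G g Rs w (col' 0 lam)) x e.
  by apply: diff_derivable; exact: differentiable_G.
have hE : (fun w => G g Rs w (col' 0 lam) + lam 0 0 * R1 p psi w) =
    (fun w => G g Rs w (col' 0 lam)) + lam 0 0 *: S.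
  by apply/funext => w; rewrite /R1 /S !fctE /= fct_sumE.
have [dR1p dR1E] := dR1.
have dSZ : derivable (lam 0 0 *: S) x e by exact: derivableZ.
have dh :
    derivable (fun w => G g Rs w (col' 0 lam) + lam 0 0 * R1 p psi w) x e.
  by rewrite hE; exact: derivableD.
have := derive_regular_subgradient vP dh.
rewrite dot_delta => <-.
by rewrite hE (deriveD dG dSZ) deriveZ// dR1E stationarityE.
Qed.

Lemma continuous_partial (R : realType) (n : nat) (F : 'rV[R]_n -> R)
    (j : 'I_n) : C2 F -> continuous (partial j F).
Proof.
move=> [_ h] x; apply: differentiable_continuous.
by have [] := h (delta_mx 0 j) x.
Qed.

(** The approximating points eventually have a nonzero j-th coordinate, so the regular case applies
    to them; the identity passes to the limit because [stationarity] is continuous in w at x for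
    fixed lambda. *)
Lemma general_subgradient_stationarity (R : realType) (n m : nat) (p : R)
    (psi dpsi ddpsi : R -> R) (g : 'rV[R]_n -> R) (Rs : 'I_m -> 'rV[R]_n -> R)
    (lam : 'rV[R]_m.+1) (x v : 'rV[R]_n) (j : 'I_n) :
  derivative_on_nonneg psi dpsi -> derivative_on_nonneg dpsi ddpsi ->
  C2 g -> (forall i, C2 (Rs i)) -> x 0 j != 0 ->
  general_subgradient
    (fun w => G g Rs w (col' 0 lam) + lam 0 0 * R1 p psi w) x v ->
  v 0 j = stationarity p dpsi g Rs j x lam.
Proof.
move=> dP ddP gC2 RsC2 xj0 [x_ [v_ [xx vv subg]]].
have dg y : differentiable g y by have [[]] := gC2.1 y.
have dRs i y : differentiable (Rs i) y by have [[]] := (RsC2 i).1 y.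
have vj : v_ k 0 j @[k --> \oo] --> v 0 j.
  apply: (@cvg_comp _ _ _ v_ (fun w : 'rV[R]_n => w 0 j) _ _ _ vv).
  exact: coord_continuous.
pose sumRs (w : 'rV[R]_n) :=
  \sum_(i < m) col' 0 lam 0 i * partial j (Rs i) w.
pose pen (w : 'rV[R]_n) := dpenalty p dpsi (w 0 j).
have Sc : {for x, continuous (fun w => stationarity p dpsi g Rs j w lam)}.
  rewrite (_ : (fun w => _) =
    (fun w => partial j g w + sumRs w + lam 0 0 * pen w)); last first.
    by apply/funext => w; rewrite stationarityE /partial derive_G.
  have c1 : {for x, continuous (partial j g)} by exact: continuous_partial.
  have c2 : {for x, continuous sumRs}.
    apply: (@continuous_at_sum R 'rV[R]_n m
      (fun i w => col' 0 lam 0 i * partial j (Rs i) w)) => i.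
    apply: (@continuous_at_mul R 'rV[R]_n (fun=> col' 0 lam 0 i)).
      exact: continuous_at_cst.
    exact: (continuous_partial (RsC2 i) (x := x)).
  have c3 : {for x, continuous pen}.
    apply: (@continuous_comp _ _ _ (fun w : 'rV[R]_n => w 0 j)
      (dpenalty p dpsi)); first exact: coord_continuous.
    exact: continuous_dpenalty ddP xj0.
  have c4 : {for x, continuous (fun w => partial j g w + sumRs w)}.
    exact: continuous_at_add.
  apply: (@continuous_at_add R 'rV[R]_n _ _ x c4).
  apply: (@continuous_at_mul R 'rV[R]_n (fun=> lam 0 0)) => //.
  exact: continuous_at_cst.
have Sx : stationarity p dpsi g Rs j (x_ k) lam @[k --> \oo]
    --> stationarity p dpsi g Rs j x lam.
  exact: (@cvg_comp _ _ _ x_ _ _ _ _ xx Sc).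
have xk0 : \forall k \near \oo, x_ k 0 j != 0.
  have xj : x_ k 0 j @[k --> \oo] --> x 0 j.
    apply: (@cvg_comp _ _ _ x_ (fun w : 'rV[R]_n => w 0 j) _ _ _ xx).
    exact: coord_continuous.
  have nx : nbhs (x 0 j) [set t : R | t != 0].
    by apply: open_nbhs_nbhs; split => //; exact: open_neq.
  exact: (xj _ nx).
have vS : v_ k 0 j @[k --> \oo] --> stationarity p dpsi g Rs j x lam.
  apply: cvg_trans Sx; apply: near_eq_cvg; near=> k.
  apply/esym; apply: (regular_subgradient_stationarity dP) (subg k) => //.
  by near: k.
exact: (cvg_unique _ vj vS).
Unshelve. all: by end_near. Qed.

(** * From the stationarity equations to regular subgradients *)

Lemma regular_subgradient0 (R : realType) (n : nat) (h : 'rV[R]_n -> R)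
    (w : 'rV[R]_n) :
  (forall e, 0 < e -> \forall x \near w, - (e * `|x - w|) <= h x - h w) ->
  regular_subgradient h w 0.
Proof.
(* The remainder is the increment cut off above at 0: it never exceeds the increment, and only the
   lower bound [hw] is needed to make it a little-o. *)
move=> hw; exists (fun x => Num.min 0 (h x - h w)); last first.
  move=> x; rewrite /dot big1 ?addr0; last by move=> i _; rewrite mxE mul0r.
  by rewrite addrC -lerBrDr ge_min lexx orbT.
apply/eqoP => e e0 /=; near=> x.
have hx : - (e * `|x - w|) <= h x - h w by near: x; exact: hw.
have ex : 0 <= e * `|x - w| by rewrite mulr_ge0// ltW.
rewrite ler_norml; apply/andP; split; first by rewrite le_min hx oppr_le0 ex.
by rewrite ge_min ex.
Unshelve. all: by end_near. Qed.

Lemma differentiable_near_le (R : realType) (V : normedModType R) (F : V -> R)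
    (x : V) (e : R) : differentiable F x -> 0 < e ->
  \forall y \near x, `|F y - F x - 'D_(y - x) F x| <= e * `|y - x|.
Proof.
move=> dF e0; have /eqaddoP/(_ _ e0) := diff_locally dF.
move=> h; rewrite (near_shift 0); apply: filterS h => y.
by rewrite !fctE /= subr0 addrK opprD addrA deriveE.
Qed.

Lemma stationarity_regular_subgradient (R : realType) (n m : nat) (p : R)
    (psi dpsi : R -> R) (g : 'rV[R]_n -> R) (Rs : 'I_m -> 'rV[R]_n -> R)
    (lam : 'rV[R]_m.+1) (w : 'rV[R]_n) :
  0 < p -> p < 1 -> derivative_on_nonneg psi dpsi -> 0 < dpsi 0 ->
  differentiable g w -> (forall i, differentiable (Rs i) w) ->
  0 < lam 0 0 ->
  (forall j, w 0 j != 0 -> stationarity p dpsi g Rs j w lam = 0) ->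
  regular_subgradient
    (fun w => G g Rs w (col' 0 lam) + lam 0 0 * R1 p psi w) w 0.
Proof.
move=> p0 p1 dP dpsi0 dg dRs l0 stat.
pose Gl := fun w => G g Rs w (col' 0 lam).
pose P i := fun w : 'rV[R]_n => psi (`|w 0 i| `^ p).
pose Q i : 'rV[R]_n -> R := if w 0 i == 0 then cst 0 else P i.
pose pen0 (x : 'rV[R]_n) := lam 0 0 * \sum_(i | w 0 i == 0) P i x.
(* The objective is K + pen0 with K differentiable at w; stationarity leaves in
   the derivative of K only the coordinates vanishing at w, where the slope of
   K is absorbed by pen0. *)
pose K : 'rV[R]_n -> R := Gl + lam 0 0 *: \sum_(i < n) Q i.
have dGl : differentiable Gl w by exact: differentiable_G.
have dQ i : differentiable (Q i) w.
  rewrite /Q; case: eqVneq => [_|wi0]; first exact: differentiable_cst.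
  exact: differentiable_coord_psi dP wi0.
have dSQ : differentiable (\sum_(i < n) Q i) w by exact: differentiable_sum.
have dK : differentiable K w.
  by apply: differentiableD => //; exact: differentiableZ.
have DK v : 'D_v K w = \sum_(i | w 0 i == 0) v 0 i * partial i Gl w.
  rewrite /K deriveD; [|exact: diff_derivable|
    by apply: derivableZ; exact: diff_derivable].
  rewrite deriveZ; last exact: diff_derivable.
  rewrite derive_sum => [|i]; last exact: diff_derivable.
  rewrite derive_partialE// [in RHS]big_mkcond/= scaler_sumr -big_split /=.
  apply: eq_bigr => i _; rewrite /Q; case: eqVneq => [_|wi0].
    by rewrite derive_cst scaler0 addr0.
  have := stat _ wi0; rewrite stationarityE -/Gl (derive_coord_psi _ _ dP wi0).
  by rewrite [_ *: _]mulrCA -mulrDr => ->; rewrite mulr0.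
(* The growth constant is the slope of [Gl] divided by lambda_1, since the penalty enters the
   objective multiplied by lambda_1. *)
have psi_near : \forall x \near w, forall i, w 0 i = 0 ->
    `|partial i Gl w / lam 0 0| * `|(x : 'rV[R]_n) 0 i| <= P i x - psi 0.
  apply: (@filter_forall _ 'I_n (fun i (x : 'rV[R]_n) => w 0 i = 0 ->
    `|partial i Gl w / lam 0 0| * `|x 0 i| <= P i x - psi 0)
    (nbhs w) (nbhs_filter w)) => i.
  case: (eqVneq (w 0 i) 0) => [wi0|wi0]; last first.
    by apply: nearW => x wi0'; rewrite wi0' eqxx in wi0.
  have := near_psi_norm_powR_ge `|partial i Gl w / lam 0 0| p0 p1 dP dpsi0.
  have := @coord_continuous R 1 n 0 i w; rewrite /continuous_at wi0 => cw hh.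
  by apply: (@filterS _ (nbhs w) (nbhs_filter w) _ _ _ (cw _ hh)) => x /= xP _.
apply: regular_subgradient0 => e e0; near=> x.
have Kx : `|K x - K w - 'D_(x - w) K w| <= e * `|x - w|.
  by near: x; exact: (differentiable_near_le dK e0).
have HE y : Gl y + lam 0 0 * R1 p psi y = K y + pen0 y.
  have -> : K y = Gl y + lam 0 0 * \sum_(i < n) Q i y.
    by rewrite /K !fctE /= fct_sumE.
  rewrite -[RHS]addrA; congr (_ + _); rewrite -mulrDr; congr (_ * _).
  rewrite /R1 [X in _ = _ + X]big_mkcond -big_split; apply: eq_bigr => i _ /=.
  by rewrite /Q; case: eqP => _; rewrite ?add0r ?addr0.
rewrite -/(Gl x) -/(Gl w) !HE.
(* The comparison is made coordinate by coordinate; what remains of the increment is the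
   differentiability error of [K], at least -e |x - w|. *)
have sumge : 0 <= 'D_(x - w) K w + (pen0 x - pen0 w).
  rewrite DK -mulrBr -sumrB mulr_sumr -big_split.
  apply: sumr_ge0 => i /eqP wi0; rewrite /= !mxE.
  have -> : P i w = psi 0 by rewrite /P wi0 normr0 powR0 ?gt_eqF.
  rewrite wi0 subr0.
  have psi_ge : `|partial i Gl w / lam 0 0| * `|x 0 i| <= P i x - psi 0.
    by move: i wi0; near: x.
  have -> : x 0 i * partial i Gl w =
      lam 0 0 * (partial i Gl w / lam 0 0 * x 0 i).
    by field; rewrite gt_eqF.
  rewrite -mulrDr mulr_ge0 ?(ltW l0)// addrC -[X in _ + X]opprK subr_ge0.
  by apply: le_trans psi_ge; rewrite -normrM -normrN ler_norm.
move: Kx; rewrite ler_norml => /andP[Kx _].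
rewrite -[leLHS]addr0; apply: le_trans (lerD Kx sumge) _.
by rewrite le_eqVlt; apply/orP; left; apply/eqP; ring.
Unshelve. all: by end_near. Qed.

(** * Derivatives of functions of one factor of a product space *)

Section ProductDerivatives.
Variables (R : realType) (U V W : normedModType R).
Implicit Types (z v : (U * V)%type).

Lemma differentiable_comp_fst (F : U -> W) z :
  differentiable F z.1 -> differentiable (F \o fst) z.
Proof.
move=> dF; apply: differentiable_comp => //.
by apply: linear_differentiable => y; exact: cvg_fst.
Qed.

Lemma derive_comp_fst (F : U -> W) z v :
  differentiable F z.1 -> 'D_v (F \o fst) z = 'D_(v.1) F z.1.
Proof.
move=> dF.
have cfst : continuous (fst : U * V -> U) by move=> y; exact: cvg_fst.
have dfst : differentiable (fst : U * V -> U) z by exact: linear_differentiable.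
rewrite deriveE; last exact: differentiable_comp_fst.
by rewrite diff_comp//= (diff_lin _ cfst) deriveE.
Qed.

Lemma differentiable_comp_snd (F : V -> W) z :
  differentiable F z.2 -> differentiable (F \o snd) z.
Proof.
move=> dF; apply: differentiable_comp => //.
by apply: linear_differentiable => y; exact: cvg_snd.
Qed.

Lemma derive_comp_snd (F : V -> W) z v :
  differentiable F z.2 -> 'D_v (F \o snd) z = 'D_(v.2) F z.2.
Proof.
move=> dF.
have csnd : continuous (snd : U * V -> V) by move=> y; exact: cvg_snd.
have dsnd : differentiable (snd : U * V -> V) z by exact: linear_differentiable.
rewrite deriveE; last exact: differentiable_comp_snd.
by rewrite diff_comp//= (diff_lin _ csnd) deriveE.
Qed.

End ProductDerivatives.

(** * Smoothness of the stationarity equation jointly in (w, lambda) *)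

Section StationarityDerivative.
Variables (R : realType) (n m : nat) (p : R) (dpsi ddpsi : R -> R).
Variables (g : 'rV[R]_n -> R) (Rs : 'I_m -> 'rV[R]_n -> R) (j : 'I_n).
Hypothesis dpsi_derivative : derivative_on_nonneg dpsi ddpsi.
Hypothesis g_C2 : C2 g.
Hypothesis Rs_C2 : forall i, C2 (Rs i).
Let V : normedModType R := ('rV[R]_n * 'rV[R]_m.+1)%type.
Implicit Types (z v : V).

(** The product rule applied to [stationarity] in direction [v]. The formula is defined at every
    [z], and is the actual derivative where the j-th coordinate of [z.1] is nonzero. *)
Definition dstationarity v z : R :=
  'D_(v.1) (partial j g) z.1
  + \sum_(i < m) (z.2 0 (lift 0 i) * 'D_(v.1) (partial j (Rs i)) z.1
                  + partial j (Rs i) z.1 * v.2 0 (lift 0 i))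
  + (z.2 0 0 * (v.1 0 j * ddpenalty p dpsi ddpsi (z.1 0 j))
     + dpenalty p dpsi (z.1 0 j) * v.2 0 0).

(** The factors of [stationarity] as functions on the product space: a hyperparameter, a partial
    derivative, and the penalty derivative. *)
Let c k : V -> R := (fun lam : 'rV[R]_m.+1 => lam 0 k) \o snd.
Let P (F : 'rV[R]_n -> R) : V -> R := partial j F \o fst.
Let wt : V -> R := (dpenalty p dpsi \o (fun w : 'rV[R]_n => w 0 j)) \o fst.

Lemma stationarity_prodE :
  (fun z : V => stationarity p dpsi g Rs j z.1 z.2) =
  P g + \sum_(i < m) (c (lift 0 i) * P (Rs i)) + c 0 * wt.
Proof.
apply/funext => z; rewrite stationarityE {1}/partial derive_G.
- rewrite !fctE fct_sumE /=; congr (_ + _ + _).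
  by apply: eq_bigr => i _; rewrite mxE.
- by have [[]] := g_C2.1 z.1.
- by move=> i; have [[]] := (Rs_C2 i).1 z.1.
Qed.

Lemma differentiable_partial (F : 'rV[R]_n -> R) x :
  C2 F -> differentiable (partial j F) x.
Proof. by move=> [_ h]; have [] := h (delta_mx 0 j) x. Qed.

Let dc k z : differentiable (c k) z.
Proof. by apply: differentiable_comp_snd; exact: differentiable_coord. Qed.

Let dPF F z : C2 F -> differentiable (P F) z.
Proof.
by move=> hF; apply: differentiable_comp_fst; exact: differentiable_partial.
Qed.

Let dwt z : z.1 0 j != 0 -> differentiable wt z.
Proof.
move=> zj0; apply: differentiable_comp_fst.
apply: (differentiable_real_comp _ (is_derive_dpenalty p dpsi_derivative zj0)).
exact: differentiable_coord.
Qed.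

Lemma differentiable_stationarity z : z.1 0 j != 0 ->
  differentiable (fun z : V => stationarity p dpsi g Rs j z.1 z.2) z.
Proof.
move=> zj0; rewrite stationarity_prodE.
apply: (differentiableD (differentiableD (dPF z g_C2) _)); last first.
  exact: (differentiableM (dc 0 z) (dwt zj0)).
apply: differentiable_sum => i.
exact: (differentiableM (dc (lift 0 i) z) (dPF z (Rs_C2 i))).
Qed.

Lemma derive_stationarity z v : z.1 0 j != 0 ->
  'D_v (fun z : V => stationarity p dpsi g Rs j z.1 z.2) z = dstationarity v z.
Proof.
move=> zj0; rewrite stationarity_prodE.
have d1 : derivable (P g) z v by exact: (diff_derivable (dPF z g_C2)).
have d2 i : derivable (c (lift 0 i) * P (Rs i)) z v.
  exact: (diff_derivable (differentiableM (dc (lift 0 i) z) (dPF z (Rs_C2 i)))).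
have d3 : derivable (\sum_(i < m) (c (lift 0 i) * P (Rs i))) z v.
  exact: derivable_sum.
have d4 : derivable (c 0 * wt) z v.
  exact: (diff_derivable (differentiableM (dc 0 z) (dwt zj0))).
have d5 k : derivable (c k) z v by exact: (diff_derivable (dc k z)).
have d6 i : derivable (P (Rs i)) z v.
  exact: (diff_derivable (dPF z (Rs_C2 i))).
have d7 : derivable wt z v by exact: (diff_derivable (dwt zj0)).
have Dc k : 'D_v (c k) z = v.2 0 k.
  by rewrite derive_comp_snd ?derive_coord//; exact: differentiable_coord.
have DP F : C2 F -> 'D_v (P F) z = 'D_(v.1) (partial j F) z.1.
  by move=> hF; rewrite derive_comp_fst//; exact: differentiable_partial.
have Dwt : 'D_v wt z = v.1 0 j * ddpenalty p dpsi ddpsi (z.1 0 j).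
  rewrite derive_comp_fst; last first.
    apply: (differentiable_real_comp _
      (is_derive_dpenalty p dpsi_derivative zj0)).
    exact: differentiable_coord.
  rewrite (derive_real_comp _ _ (is_derive_dpenalty p dpsi_derivative zj0)).
    by rewrite derive_coord.
  exact: differentiable_coord.
rewrite (deriveD (derivableD d1 d3) d4) (deriveD d1 d3) (derive_sum d2).
rewrite (deriveM (d5 0) d7) Dc Dwt (DP _ g_C2) /dstationarity.
congr (_ + _ + _); apply: eq_bigr => i _.
by rewrite (deriveM (d5 (lift 0 i)) (d6 i)) Dc (DP _ (Rs_C2 i)).
Qed.

Lemma near_coord_neq0 (z : V) : z.1 0 j != 0 ->
  \forall y \near z, (y : V).1 0 j != 0.
Proof.
move=> zj0.
have cc : {for z, continuous (fun y : V => y.1 0 j)}.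
  apply: (@continuous_comp _ _ _ fst (fun w : 'rV[R]_n => w 0 j)).
    exact: cvg_fst.
  exact: coord_continuous.
have nz : nbhs (z.1 0 j) [set t : R | t != 0].
  by apply: open_nbhs_nbhs; split => //; exact: open_neq.
exact: (cc _ nz).
Qed.

Lemma continuous_dstationarity v z :
  {within [set t | 0 <= t], continuous ddpsi} -> z.1 0 j != 0 ->
  {for z, continuous (dstationarity v)}.
Proof.
move=> ddc zj0.
have cf (F : 'rV[R]_n -> R) :
    {for z.1, continuous F} -> {for z, continuous (fun y : V => F y.1)}.
  by move=> Fc; apply: (@continuous_comp _ _ _ fst F); first exact: cvg_fst.
have cs k : {for z, continuous (fun y : V => y.2 0 k)}.
  apply: (@continuous_comp _ _ _ snd (fun w : 'rV[R]_m.+1 => w 0 k)).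
    exact: cvg_snd.
  exact: coord_continuous.
have cD F :
    C2 F -> {for z, continuous (fun y : V => 'D_(v.1) (partial j F) y.1)}.
  by move=> [_ h]; have [_ hc] := h (delta_mx 0 j) z.1; exact: (cf _ (hc v.1)).
have cP F : C2 F -> {for z, continuous (fun y : V => partial j F y.1)}.
  by move=> hF; exact: (cf _ (@continuous_partial R n F j hF z.1)).
have cj (phi : R -> R) : {for z.1 0 j, continuous phi} ->
    {for z, continuous (fun y : V => phi (y.1 0 j))}.
  move=> phic; apply: (cf (fun w => phi (w 0 j))).
  apply: (@continuous_comp _ _ _ (fun w : 'rV[R]_n => w 0 j) phi) => //.
  exact: coord_continuous.
have c0 (a : R) : {for z, continuous (fun _ : V => a)}.
  exact: continuous_at_cst.
have c1 := cD g g_C2.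
have c2 : {for z, continuous (fun y : V =>
    \sum_(i < m) (y.2 0 (lift 0 i) * 'D_(v.1) (partial j (Rs i)) y.1
                  + partial j (Rs i) y.1 * v.2 0 (lift 0 i)))}.
  apply: (@continuous_at_sum R V) => i.
  exact: (continuous_at_add
    (continuous_at_mul (cs (lift 0 i)) (cD _ (Rs_C2 i)))
    (continuous_at_mul (cP _ (Rs_C2 i)) (c0 (v.2 0 (lift 0 i))))).
have cw := cj _ (@continuous_dpenalty R p dpsi ddpsi _ dpsi_derivative zj0).
have cdw :=
  cj _ (@continuous_ddpenalty R p dpsi ddpsi _ dpsi_derivative ddc zj0).
exact: (continuous_at_add (continuous_at_add c1 c2) (continuous_at_add
  (continuous_at_mul (cs 0) (continuous_at_mul (c0 (v.1 0 j)) cdw))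
  (continuous_at_mul cw (c0 (v.2 0 0))))).
Qed.

(** A nonzero coordinate stays nonzero nearby, so the derivative coincides with [dstationarity] on a
    neighbourhood and inherits its continuity. *)
Lemma continuously_differentiable_stationarity z :
  {within [set t | 0 <= t], continuous ddpsi} -> z.1 0 j != 0 ->
  continuously_differentiable_at
    (fun z : V => stationarity p dpsi g Rs j z.1 z.2) z.
Proof.
move=> ddc zj0; split; first exact: differentiable_stationarity.
move=> v; rewrite /prop_for /continuous_at derive_stationarity//.
apply: cvg_trans (continuous_dstationarity (v := v) ddc zj0).
apply: near_eq_cvg; near=> y.
apply/esym; apply: derive_stationarity.
near: y; exact: near_coord_neq0.
Unshelve. all: by end_near. Qed.

End StationarityDerivative.

(** * Affine constraints and index sets *)

Lemma continuously_differentiable_linear (R : realType) (V : normedModType R)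
    (F L : V -> R) (z : V) :
  (forall y, differentiable F y) -> (forall y v, 'D_v F y = L v) ->
  continuously_differentiable_at F z.
Proof.
move=> dF DF; split => // v; rewrite (_ : 'D_v F = fun=> L v).
  exact: continuous_at_cst.
by apply/funext => y; rewrite DF.
Qed.

Lemma differentiable_affine_coord (R : realType) (k : nat) (i : 'I_k)
    (c l : 'rV[R]_k) : differentiable (fun l : 'rV[R]_k => (l - c) 0 i) l.
Proof.
rewrite (_ : (fun l => _) = (fun l : 'rV[R]_k => l 0 i) + cst (- c 0 i)).
  exact: (differentiableD (differentiable_coord l 0 i)
    (differentiable_cst _ _)).
by apply/funext => x; rewrite !fctE !mxE.
Qed.

Lemma derive_affine_coord (R : realType) (k : nat) (i : 'I_k)
    (c l v : 'rV[R]_k) : 'D_v (fun l : 'rV[R]_k => (l - c) 0 i) l = v 0 i.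
Proof.
rewrite (_ : (fun l => _) = (fun l : 'rV[R]_k => l 0 i) + cst (- c 0 i)).
  rewrite (deriveD (diff_derivable (differentiable_coord l 0 i))
    (derivable_cst _ _ _)).
  by rewrite derive_coord derive_cst addr0.
by apply/funext => x; rewrite !fctE !mxE.
Qed.

Lemma OmegaP (R : realType) (m : nat) (eps : R) (lam : 'rV[R]_m.+1) :
  Omega eps lam <-> forall k, 0 <= (lam - eps *: e1 R m) 0 k.
Proof.
have E0 : (lam - eps *: e1 R m) 0 0 = lam 0 0 - eps.
  by rewrite /e1 !mxE !eqxx mulr1.
have E1 i : (lam - eps *: e1 R m) 0 (lift 0 i) = lam 0 (lift 0 i).
  by rewrite /e1 !mxE mulr0 subr0.
split=> [[l0 l1] k|h].
  by case: (unliftP 0 k) => [i|] ->; rewrite ?E1 ?E0 ?subr_ge0.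
by split => [|i]; [rewrite -subr_ge0 -E0|rewrite -E1].
Qed.

Lemma in_zero_indices (R : realType) (n : nat) (w : 'rV[R]_n) (j : 'I_n) :
  (j \in zero_indices w) = (w 0 j == 0).
Proof. by rewrite finset.in_set. Qed.

(** * Derivatives of the stationarity equations along basis vectors *)

Section DirectionalDerivatives.
Variables (R : realType) (n m : nat) (p : R) (dpsi ddpsi : R -> R).
Variables (g : 'rV[R]_n -> R) (Rs : 'I_m -> 'rV[R]_n -> R).
Hypothesis g_C2 : C2 g.
Hypothesis Rs_C2 : forall i, C2 (Rs i).
Implicit Types (w : 'rV[R]_n) (lam : 'rV[R]_m.+1) (i j : 'I_n).

Lemma hessian_G w (lbar : 'rV[R]_m) i j :
  hessian (fun w' => G g Rs w' lbar) w i j =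
  partial i (partial j g) w
    + \sum_(k < m) lbar 0 k * partial i (partial j (Rs k)) w.
Proof.
(* A partial derivative of [G] is again a [G], built from the partial derivatives of its
   ingredients, so [derive_G] can be applied twice. *)
rewrite mxE (_ : partial j _ =
  fun w => G (partial j g) (fun k => partial j (Rs k)) w lbar).
  have dg := @differentiable_partial R n j g w g_C2.
  have dRs k := @differentiable_partial R n j (Rs k) w (Rs_C2 k).
  by rewrite {1}/partial (derive_G _ _ dg dRs).
have dg x : differentiable g x by have [[]] := g_C2.1 x.
have dRs x k : differentiable (Rs k) x by have [[]] := (Rs_C2 k).1 x.
by apply/funext => x; rewrite {1}/partial (derive_G _ _ (dg x) (dRs x)).
Qed.

(** Equation [j] differentiated along w_i is the entry (i, j), in the order used by [hessian]; the
    multiplier of equation [j] therefore meets column [j] of [Htilde]. *)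
Lemma dstationarity_Htilde w lam i j :
  dstationarity p dpsi ddpsi g Rs j (delta_mx 0 i, 0) (w, lam) =
  Htilde p dpsi ddpsi g Rs w lam i j.
Proof.
rewrite /dstationarity /Htilde [in RHS]mxE hessian_G /= !mxE /= mulr0 addr0.
congr (_ + _ + _).
  by apply: eq_bigr => k _; rewrite !mxE mulr0 addr0.
rewrite eq_sym; case: eqVneq => [->|ij].
  by rewrite mul1r mulr1n /ddpenalty; ring.
by rewrite mul0r mulr0 mulr0n.
Qed.

(** Together with [dstationarity_lamS], supplies the coefficients of zeta in the formulas for
    eta. *)
Lemma dstationarity_lam0 w lam j :
  dstationarity p dpsi ddpsi g Rs j (0, delta_mx 0 0) (w, lam) =
  dpenalty p dpsi (w 0 j).
Proof.
rewrite /dstationarity /= derive0 add0r !mxE mul0r mulr0 add0r mulr1.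
rewrite big1 ?add0r// => k _.
by rewrite derive0 !mxE mulr0 add0r mulr0.
Qed.

Lemma dstationarity_lamS w lam j (k : 'I_m) :
  dstationarity p dpsi ddpsi g Rs j (0, delta_mx 0 (lift 0 k)) (w, lam) =
  partial j (Rs k) w.
Proof.
rewrite /dstationarity /= derive0 add0r !mxE mul0r mulr0 add0r mulr0 addr0.
rewrite (bigD1 k)//= derive0 mulr0 add0r mxE !eqxx mulr1 big1 ?addr0// => l lk.
by rewrite derive0 mulr0 add0r mxE (inj_eq lift_inj) (negbTE lk) andbF mulr0.
Qed.

End DirectionalDerivatives.

(** * Feasibility and smoothness of the reduced system *)

Section ReducedSystem.
Variables (R : realType) (n m : nat).
Variables (g : 'rV[R]_n -> R) (Rs : 'I_m -> 'rV[R]_n -> R).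
Hypotheses (g_C2 : C2 g) (Rs_C2 : forall i, C2 (Rs i)).
Variables (eps : R) (psi dpsi ddpsi : R -> R) (p : R).
Hypothesis eps_gt0 : 0 < eps.
Hypothesis psi_derivative : derivative_on_nonneg psi dpsi.
Hypothesis dpsi_derivative : derivative_on_nonneg dpsi ddpsi.
Hypothesis ddpsi_continuous : {within [set t | 0 <= t], continuous ddpsi}.
Hypothesis dpsi0_gt0 : 0 < dpsi 0.
Hypotheses (p_gt0 : 0 < p) (p_lt1 : p < 1).
Variables (w : 'rV[R]_n) (lam : 'rV[R]_m.+1).
Let V : normedModType R := ('rV[R]_n * 'rV[R]_m.+1)%type.
Let sys := reduced_system p eps dpsi g Rs (zero_indices w).

(** By feasibility a nonzero coordinate of [z.1] lies outside the fixed index set, so its equation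
    is the stationarity one. Since lambda_1 >= eps > 0, 0 is then a regular subgradient at [z.1]
    itself, and constant sequences exhibit it as a general one. *)
Lemma reduced_feasible_bilevel (z : V) :
  (forall j, w 0 j != 0 -> z.1 0 j != 0) ->
  feasible sys z -> bilevel_feasible p eps psi g Rs z.
Proof.
move=> zw [/= eqz ineqz]; have Oz : Omega eps z.2 by apply/OmegaP.
split=> //; exists (fun=> z.1), (fun=> 0).
split; [exact: cvg_cst|exact: cvg_cst|] => _.
apply: (stationarity_regular_subgradient p_gt0 p_lt1 psi_derivative) => //.
- by have [[]] := g_C2.1 z.1.
- by move=> i; have [[]] := (Rs_C2 i).1 z.1.
- by case: Oz => + _; exact: lt_le_trans.
- move=> j zj0; have := eqz j; case: ifP => // _ zj.
  by rewrite zj eqxx in zj0.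
Qed.

Lemma smooth_near_reduced : smooth_near sys (w, lam).
Proof.
pose z0 : V := (w, lam); have Fz0 := nbhs_filter z0.
split=> [j|k] /=.
  (* The stationarity equation is imposed only where w_j <> 0, away from the singularity of the
     powers; the other equalities are linear. *)
  case jI : (j \in zero_indices w); last first.
    have wj0 : w 0 j != 0 by rewrite -in_zero_indices jI.
    have := @near_coord_neq0 R n m j z0 wj0.
    apply: (@filterS _ (nbhs z0) Fz0) => y yj0.
    exact: (@continuously_differentiable_stationarity R n m p dpsi ddpsi g Rs
      j dpsi_derivative g_C2 Rs_C2 y ddpsi_continuous yj0).
  apply: (@filterE _ (nbhs z0) Fz0) => y.
  pose c (w : 'rV[R]_n) := w 0 j.
  apply: (@continuously_differentiable_linear _ _ _ (fun v : V => v.1 0 j)).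
  - move=> z; apply: (differentiable_comp_fst (F := c)).
    exact: differentiable_coord.
  - move=> z v; rewrite (derive_comp_fst (F := c)) ?derive_coord//.
    exact: differentiable_coord.
apply: (@filterE _ (nbhs z0) Fz0) => y.
pose c (l : 'rV[R]_m.+1) := (l - eps *: e1 R m) 0 k.
apply: (@continuously_differentiable_linear _ _ _ (fun v : V => v.2 0 k)).
- move=> z; apply: (differentiable_comp_snd (F := c)).
  exact: differentiable_affine_coord.
- move=> z v; rewrite (derive_comp_snd (F := c)) ?derive_affine_coord//.
  exact: differentiable_affine_coord.
Qed.

End ReducedSystem.

(** * Reduction to the smooth problem and translation of its multipliers *)

Theorem proposition3p3 (R : realType) (n m : nat) (n_ge1 : (1 <= n)%N)
    (f g : 'rV[R]_n -> R) (Rs : 'I_m -> 'rV[R]_n -> R)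
    (f_C1 : C1 f) (g_C2 : C2 g) (Rs_C2 : forall i, C2 (Rs i))
    (eps : R) (eps_gt0 : 0 < eps)
    (psi dpsi ddpsi : R -> R)
    (psi_derivative : derivative_on_nonneg psi dpsi)
    (dpsi_derivative : derivative_on_nonneg dpsi ddpsi)
    (ddpsi_continuous : {within [set t | 0 <= t], continuous ddpsi})
    (alpha beta : R) (alpha_gt0 : 0 < alpha) (beta_gt0 : 0 < beta)
    (dpsi_bounds : forall t, 0 <= t -> 0 < dpsi t /\ dpsi t <= alpha)
    (ddpsi_bounds : forall t, 0 <= t -> - beta <= ddpsi t /\ ddpsi t <= 0)
    (p : R) (p_gt0 : 0 < p) (p_lt1 : p < 1)
    (w : 'rV[R]_n) (lam : 'rV[R]_m.+1)
    (local_opt :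
      local_minimizer (fun z : 'rV[R]_n * 'rV[R]_m.+1 => f z.1)
        (bilevel_feasible p eps psi g Rs) (w, lam))
    (Q : constraint_system R ('rV[R]_n * 'rV[R]_m.+1) ->
         'rV[R]_n * 'rV[R]_m.+1 -> Prop)
    (Q_cq : constraint_qualification
              (fun z : 'rV[R]_n * 'rV[R]_m.+1 => f z.1) Q)
    (Q_holds : Q (reduced_system p eps dpsi g Rs (zero_indices w)) (w, lam)) :
  BKKT_point p eps dpsi ddpsi f g Rs w lam.
Proof.
pose V : normedModType R := ('rV[R]_n * 'rV[R]_m.+1)%type.
pose I := zero_indices w.
pose sys := reduced_system p eps dpsi g Rs I.
pose z0 : V := (w, lam).
have dpsi0_gt0 : 0 < dpsi 0 by have [] := dpsi_bounds 0 (lexx 0).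
have [[subg /= Olam] nearmin] := local_opt.
have stat0 j : w 0 j != 0 -> stationarity p dpsi g Rs j w lam = 0.
  move=> wj0.
  have := general_subgradient_stationarity psi_derivative dpsi_derivative
    g_C2 Rs_C2 wj0 subg.
  by rewrite mxE => <-.
have inI j : (j \in I) = (w 0 j == 0) by exact: in_zero_indices.
have fz0 : feasible sys z0.
  split=> [j|]; last by apply/OmegaP.
  by rewrite /= inI; case: eqVneq => // /stat0.
(* Near [z0] reduced feasibility implies bilevel feasibility, and [z0] satisfies both, so local
   minimality is inherited. *)
have locmin : local_minimizer (fun z : V => f z.1) (feasible sys) z0.
  split=> //.
  have nz0 : \forall y \near z0, forall j, w 0 j != 0 -> (y : V).1 0 j != 0.
    apply: (@filter_forall _ 'I_n (fun j (y : V) => w 0 j != 0 -> y.1 0 j != 0)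
      (nbhs z0) (nbhs_filter z0)) => j.
    have [wj0|wj0] := eqVneq (w 0 j) 0.
      by apply: (@filterE _ (nbhs z0) (nbhs_filter z0)).
    apply: (@filterS _ (nbhs z0) (nbhs_filter z0) _ _ _
      (@near_coord_neq0 R n m j z0 wj0)).
    by move=> y yj0 _.
  apply: (@filterS2 _ (nbhs z0) (nbhs_filter z0) _ _ _ _ nz0 nearmin).
  move=> y yw ymin fy; apply: ymin.
  exact: (reduced_feasible_bilevel g_C2 Rs_C2 eps_gt0 psi_derivative
    dpsi0_gt0 p_gt0 p_lt1 yw fy).
have smooth : smooth_near sys z0.
  exact: (@smooth_near_reduced R n m g Rs g_C2 Rs_C2 eps dpsi ddpsi p
    dpsi_derivative ddpsi_continuous w lam).
have [_ [mu [nu [/= lagr nu_ge0 compl]]]] := Q_cq sys z0 smooth Q_holds locmin.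
have df x : differentiable f x by have [] := f_C1 x.
have Df (v : V) : 'D_v (fun z : V => f z.1) z0 = 'D_(v.1) f w.
  by rewrite (derive_comp_fst (F := f)).
(* The derivative of the j-th equality along [v], covering both kinds of equality at once. *)
pose dlow (v : V) j :=
  if j \in I then v.1 0 j else dstationarity p dpsi ddpsi g Rs j v z0.
have Dlow (v : V) j : 'D_v (fun z : V => if j \in I then z.1 0 j
    else stationarity p dpsi g Rs j z.1 z.2) z0 = dlow v j.
  rewrite /dlow; case jI : (j \in I).
    rewrite (derive_comp_fst (F := fun w : 'rV[R]_n => w 0 j)) ?derive_coord//.
    exact: differentiable_coord.
  have wj0 : w 0 j != 0 by rewrite -inI jI.
  exact: (@derive_stationarity R n m p dpsi ddpsi g Rs j
    dpsi_derivative g_C2 Rs_C2 z0 v wj0).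
have Dup (v : V) k :
    'D_v (fun z : V => (z.2 - eps *: e1 R m) 0 k) z0 = v.2 0 k.
  pose c (l : 'rV[R]_m.+1) := (l - eps *: e1 R m) 0 k.
  rewrite (derive_comp_snd (F := c)) ?derive_affine_coord//.
  exact: differentiable_affine_coord.
have lagrE (v : V) :
    'D_(v.1) f w + \sum_j mu j * dlow v j = \sum_k nu k * v.2 0 k.
  have /eqP := lagr v; rewrite subr_eq0 Df => /eqP E.
  transitivity
    (\sum_k nu k * 'D_v (fun z : V => (z.2 - eps *: e1 R m) 0 k) z0).
    by rewrite -E; congr (_ + _); apply: eq_bigr => j _; rewrite Dlow.
  by apply: eq_bigr => k _; rewrite Dup.
(* Only the multipliers of the stationarity equations are kept; those of the equalities w_j = 0 are
   replaced by 0, as the BKKT conditions require. *)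
pose zeta : 'rV[R]_n := \row_j (if j \in I then 0 else mu j).
pose eta : 'rV[R]_m.+1 := \row_k nu k.
have nuE k : \sum_l nu l * (delta_mx 0 k : 'rV[R]_m.+1) 0 l = eta 0 k.
  rewrite (bigD1 k)//= !mxE !eqxx mulr1 big1 ?addr0// => l lk.
  by rewrite mxE (negbTE lk) andbF mulr0.
(* Stationarity of the Lagrangian is tested along lambda_k: neither f nor the equalities w_j = 0
   depend on lambda, so only zeta and eta remain. *)
have lagr_lam k : \sum_(j | j \notin I)
    dstationarity p dpsi ddpsi g Rs j (0, delta_mx 0 k) z0 * zeta 0 j = eta 0 k.
  rewrite -nuE; have := lagrE (0, delta_mx 0 k).
  rewrite /= derive0 add0r => <-.
  rewrite big_mkcond; apply: eq_bigr => j _; rewrite /dlow.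
  by rewrite mxE; case: (j \in I); rewrite ?mulr0 ?mxE ?mulr0// mulrC.
exists zeta, eta; split.
(* The test direction is now w_i with i outside [I], along which the bounds on lambda are
   constant. *)
- move=> i iI; have := lagrE (delta_mx 0 i, 0); rewrite /=.
  rewrite [X in _ = X -> _]big1; last by move=> k _; rewrite mxE mulr0.
  move=> lagr0; rewrite -[RHS]lagr0; congr (_ + _).
  rewrite big_mkcond; apply: eq_bigr => j _.
  rewrite /dlow [zeta 0 j]mxE -/I; case: ifPn => [jI|/negbNE jI] /=.
    by rewrite (negbTE jI) dstationarity_Htilde// mulrC.
  (* The discarded multipliers do not contribute: for j in [I] the j-th coordinate of the direction
     is 0, as i is not in [I]. *)
  rewrite jI mxE eqxx /=; case: eqVneq => [ji|_]; last by rewrite mulr0.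
  by rewrite -/I -ji jI in iI.
- move=> i; rewrite -/I inI => wi0.
  by rewrite -(stat0 _ wi0) stationarityE /dpenalty; congr (_ + _); ring.
- by move=> i iI; rewrite mxE iI.
- rewrite -(lagr_lam 0) mulr_sumr; apply: eq_bigr => j _.
  by rewrite dstationarity_lam0 /dpenalty; ring.
- move=> k; rewrite -(lagr_lam (lift 0 k)); apply: eq_bigr => j _.
  by rewrite dstationarity_lamS.
- exact/OmegaP.
- by move=> k; rewrite mxE.
- by rewrite /dot big1// => k _; rewrite mulrC [eta 0 k]mxE compl.
Qed.
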